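(* Let $\mathcal{M}_{\mathrm{BLin}}$ be the bilinear infinite counting automaton with states $\mathbb{Z}$, initial state $0$, final states $\{0\}$, and transitions in parallel as follows: for every $i\ge0$ a loop at $i$ labelled $h_i(z)$, a transition from $i$ to $i+1$ labelled $f_i(z)$ and a transition from $i+1$ to $i$ labelled $g_i(z)$; for every $i\ge1$ a loop at $-i$ labelled $h'_i(z)$; and for every $i\ge0$ a transition from $-i$ to $-(i+1)$ labelled $g'_i(z)$ and a transition from $-(i+1)$ to $-i$ labelled $f'_i(z)$. Then the generating function of $\mathcal{M}_{\mathrm{BLin}}$ is $$E_b(z)=\frac{1}{1-h_0(z)-f_0(z)g_0(z)E_1(z)-f'_0(z)g'_0(z)E'_1(z)},$$ where $$E_1(z)=\cfrac{1}{1-h_1(z)-\cfrac{f_1(z)g_1(z)}{1-h_2(z)-\cfrac{f_2(z)g_2(z)}{\ddots}}},\qquad E'_1(z)=\cfrac{1}{1-h'_1(z)-\cfrac{f'_1(z)g'_1(z)}{1-h'_2(z)-\cfrac{f'_2(z)g'_2(z)}{\ddots}}}.$$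
   Context: A transition in parallel labelled $f(z)=\sum_{n\ge1}f_nz^n$ ($f_n\in\mathbb{N}$, zero constant term) from state $p$ to state $q$ stands for: for each $n\ge1$, $f_n$ disjoint chains of $n$ transitions labelled $z$ from $p$ to $q$ through $n-1$ new hidden non-final states, from each of which only the next transition of the chain starts. The generating function of a counting automaton is $\sum_n a_nz^n$ with $a_n$ the number of paths of $n$ transitions (all transitions in parallel expanded) from the initial state to a final state. Infinite continued fractions are coefficientwise limits of their finite truncations. *)

(* Defs.v *)
From HB Require Import structures.
From mathcomp Require Import all_boot all_order all_algebra.
From mathcomp Require Import boolp classical_sets functions cardinality.

Set Implicit Arguments.
Unset Strict Implicit.
Unset Printing Implicit Defensive.

Import GRing.Theory.
Local Open Scope ring_scope.

(* A record rather than an alias of [nat -> int], on which mathcomp-classical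
   already puts the pointwise product. *)
Record fps : Type := Fps { fcoef : nat -> int }.

Lemma fpsP (a b : fps) : fcoef a =1 fcoef b -> a = b.
Proof. by case: a b => [a] [b] /= /funext ->. Qed.

HB.instance Definition _ := gen_eqMixin fps.
HB.instance Definition _ := gen_choiceMixin fps.

Definition fps0 : fps := Fps (fun=> 0).
Definition fps_opp (a : fps) : fps := Fps (fun n => - fcoef a n).
Definition fps_add (a b : fps) : fps := Fps (fun n => fcoef a n + fcoef b n).

Fact fps_addA : associative fps_add.
Proof. by move=> a b c; apply: fpsP => n /=; rewrite addrA. Qed.
Fact fps_addC : commutative fps_add.
Proof. by move=> a b; apply: fpsP => n /=; rewrite addrC. Qed.
Fact fps_add0 : left_id fps0 fps_add.
Proof. by move=> a; apply: fpsP => n /=; rewrite add0r. Qed.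
Fact fps_addN : left_inverse fps0 fps_opp fps_add.
Proof. by move=> a; apply: fpsP => n /=; rewrite addNr. Qed.

HB.instance Definition _ :=
  GRing.isZmodule.Build fps fps_addA fps_addC fps_add0 fps_addN.

Definition fps1 : fps := Fps (fun n => (n == 0%N)%:R).
Definition fps_mul (a b : fps) : fps :=
  Fps (fun n => \sum_(i < n.+1) fcoef a i * fcoef b (n - i)).

Definition fps_trunc (N : nat) (a : fps) : {poly int} :=
  \poly_(i < N) fcoef a i.

Lemma fps_mul_trunc N a b n : (n < N)%N ->
  fcoef (fps_mul a b) n = (fps_trunc N a * fps_trunc N b)`_n.
Proof.
move=> nN; rewrite coefM; apply: eq_bigr => i _.
by rewrite !coef_poly (leq_trans (ltn_ord i) nN) (leq_ltn_trans (leq_subr _ _)).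
Qed.

Fact fps_mulC : commutative fps_mul.
Proof.
by move=> a b; apply: fpsP => n; rewrite !(@fps_mul_trunc n.+1) // mulrC.
Qed.

Fact fps_mulA : associative fps_mul.
Proof.
move=> a b c; apply: fpsP => n.
transitivity (fps_trunc n.+1 a * (fps_trunc n.+1 b * fps_trunc n.+1 c))`_n.
  rewrite coefM; apply: eq_bigr => i _.
  by rewrite coef_poly ltn_ord (@fps_mul_trunc n.+1) // ltnS leq_subr.
rewrite mulrA coefM; apply: eq_bigr => i _.
by rewrite coef_poly ltnS leq_subr (@fps_mul_trunc n.+1).
Qed.

Fact fps_mul1 : left_id fps1 fps_mul.
Proof.
move=> a; apply: fpsP => n /=; rewrite big_ord_recl /= mul1r subn0.
by rewrite big1 ?addr0 // => i _; rewrite mul0r.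
Qed.

Fact fps_mulDl : left_distributive fps_mul fps_add.
Proof.
move=> a b c; apply: fpsP => n /=; rewrite -big_split /=.
by apply: eq_bigr => i _; rewrite mulrDl.
Qed.

Fact fps_oner_neq0 : fps1 != 0.
Proof. by apply/eqP => /(congr1 (fun a : fps => fcoef a 0)). Qed.

HB.instance Definition _ := GRing.Zmodule_isComNzRing.Build fps
  fps_mulA fps_mulC fps_mul1 fps_mulDl fps_oner_neq0.

(* [fps_invs a n] lists the first [n] coefficients of 1/a in reverse order. *)
Fixpoint fps_invs (a : fps) (n : nat) : seq int :=
  if n is m.+1 then
    (fcoef a 0)^-1 *
      ((m == 0%N)%:R - \sum_(i < m) fcoef a i.+1 * (fps_invs a m)`_i)
    :: fps_invs a m
  else [::].

Definition fps_unit : pred fps := fun a => fcoef a 0 \is a GRing.unit.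
Definition fps_inv (a : fps) : fps :=
  if fps_unit a then Fps (fun n => (fps_invs a n.+1)`_0) else a.

Lemma nth_fps_invs a n i : (i < n)%N ->
  (fps_invs a n)`_i = (fps_invs a (n - i))`_0.
Proof.
elim: n i => [|n IHn] [|i] //= lt_in.
by rewrite IHn.
Qed.

Fact fps_mulV : {in fps_unit, left_inverse 1 fps_inv *%R}.
Proof.
move=> a ua; rewrite mulrC; apply: fpsP => n.
have ua' : fps_unit a by [].
rewrite /fps_inv ua' /= big_ord_recl subn0.
rewrite [X in X + _]mulrA divrr // mul1r.
rewrite [X in _ + X](_ : _ = \sum_(i < n) fcoef a i.+1 * (fps_invs a n)`_i).
  by rewrite subrK.
apply: eq_bigr => i _; rewrite (nth_fps_invs _ (ltn_ord i)).
by rewrite [(n - i)%N](_ : _ = (n - i.+1).+1) // subnSK.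
Qed.

Fact fps_unitP a b : b * a = 1 -> fps_unit a.
Proof.
move=> /(congr1 (fun c : fps => fcoef c 0)) /=.
rewrite big_ord1 subnn => ba1; apply/unitrP; exists (fcoef b 0).
by split; rewrite // mulrC.
Qed.

Fact fps_inv_out : {in [predC fps_unit], fps_inv =1 id}.
Proof.
move=> a ua; rewrite /fps_inv ifF //; apply/negbTE; exact: ua.
Qed.

HB.instance Definition _ := GRing.ComNzRing_hasMulInverse.Build fps
  fps_mulV fps_unitP fps_inv_out.

Definition ser (f : nat -> nat) : fps := Fps (fun n => (f n)%:Z).

Definition fps_cvg (u : nat -> fps) (l : fps) : Prop :=
  forall n, exists N, forall m, (N <= m)%N -> fcoef (u m) n = fcoef l n.

(* 1/(1 - b_i - c_i/(1 - b_(i+1) - c_(i+1)/( ... /(1 - b_(i+N))))) *)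
Fixpoint cfrac_trunc (b c : nat -> fps) (N i : nat) : fps :=
  if N is N'.+1 then (1 - b i - c i * cfrac_trunc b c N' i.+1)^-1
  else (1 - b i)^-1.

Definition is_cfrac (b c : nat -> fps) (i : nat) (E : fps) : Prop :=
  fps_cvg (fun N => cfrac_trunc b c N i) E.

(* The edges form a type of their own: distinct edges may share both ends. *)
Record automaton : Type := Automaton {
  state : Type;
  edge : Type;
  esrc : edge -> state;
  etgt : edge -> state;
  init : state;
  final : set state }.

Fixpoint is_walk (A : automaton) (p : state A) (s : seq (edge A))
    (q : state A) : Prop :=
  if s is e :: s' then esrc e = p /\ is_walk (etgt e) s' q else p = q.

Definition accepting_paths (A : automaton) (n : nat) : set (seq (edge A)) :=
  [set s | size s = n /\ exists2 q, final q & is_walk (init A) s q]%classic.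
Arguments accepting_paths : clear implicits.

(* In particular, there are finitely many accepting paths of each length. *)
Definition is_genfun (A : automaton) (E : fps) : Prop :=
  forall n, exists2 k : nat, fcoef E n = k%:Z
    & (accepting_paths A n #= `I_k)%card.

Record pautomaton : Type := PAutomaton {
  pstate : Type;
  ptrans : Type;
  psrc : ptrans -> pstate;
  ptgt : ptrans -> pstate;
  plabel : ptrans -> nat -> nat;
  pinit : pstate;
  pfinal : set pstate }.

Section Expansion.
Variable P : pautomaton.

(* One of the [plabel t n] chains of length [n] that [t] stands for. *)
Record chain : Type := Chain {
  ctrans : ptrans P;
  clen : nat;
  cindex : 'I_(plabel ctrans clen) }.

(* The [n - 1] hidden states of a chain of length [n] are numbered from 0. *)
Inductive xstate : Type :=
  | Visible of pstate P
  | Hidden (c : chain) of 'I_(clen c).-1.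

(* The nodes met along [c], for [0 <= k <= clen c]: the source, the hidden
   states in order, the target. *)
Definition chain_node (c : chain) (k : nat) : xstate :=
  if k is j.+1 then
    if insub j is Some j' then @Hidden c j' else Visible (ptgt (ctrans c))
  else Visible (psrc (ctrans c)).

(* The [j]-th edge of [c] joins its nodes [j] and [j + 1]. A chain of length 0
   has neither edges nor hidden states. *)
Record xedge : Type := XEdge { echain : chain; epos : 'I_(clen echain) }.

Definition xfinal : set xstate :=
  fun x => if x is Visible q then pfinal q else False.

Definition expand : automaton :=
  @Automaton xstate xedge
    (fun e => chain_node (echain e) (epos e))
    (fun e => chain_node (echain e) (epos e).+1)
    (Visible (pinit P)) xfinal.

End Expansion.

Inductive blin_trans : Type :=
  | Loop of nat | Right of nat | RightBack of nat
  | Loop' of nat | Left' of nat | LeftBack' of nat.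

Section BLin.
Variables f g h f' g' h' : nat -> nat -> nat.

Definition blin_src (t : blin_trans) : int :=
  match t with
  | Loop i => i%:Z
  | Right i => i%:Z
  | RightBack i => i.+1%:Z
  | Loop' i => - i.+1%:Z
  | Left' i => - i%:Z
  | LeftBack' i => - i.+1%:Z
  end.

Definition blin_tgt (t : blin_trans) : int :=
  match t with
  | Loop i => i%:Z
  | Right i => i.+1%:Z
  | RightBack i => i%:Z
  | Loop' i => - i.+1%:Z
  | Left' i => - i.+1%:Z
  | LeftBack' i => - i%:Z
  end.

(* The primed loops start at state -1, so that [h' 0] is not used. *)
Definition blin_label (t : blin_trans) : nat -> nat :=
  match t with
  | Loop i => h i
  | Right i => f i
  | RightBack i => g i
  | Loop' i => h' i.+1
  | Left' i => g' i
  | LeftBack' i => f' i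
  end.

Definition BLin : pautomaton :=
  @PAutomaton int blin_trans blin_src blin_tgt blin_label 0 [set 0]%classic.

End BLin.

(* Main.v *)
(** The generating functions [A p] of the walks from state [p] to the final
    states satisfy the linear system [A p = [p final] + sum_t f_t * A (q_t)],
    where [t] runs over the transitions from [p], [f_t] is the label of [t] and
    [q_t] its target. As the labels have no constant term, the system
    determines [A] coefficient by coefficient, so any solution of it counts the
    walks. If [E i] are the tails of the continued fraction, i.e.
    [E i = 1 / (1 - h i - f i * g i * E (i + 1))], a solution is obtained from
    [A 0 = E_b] by [A (i + 1) = g i * E (i + 1) * A i] on the right and
    [A (- (i + 1)) = f' i * E' (i + 1) * A (- i)] on the left. *)

Require Import Defs.
From mathcomp Require Import all_boot all_order all_algebra.
From mathcomp Require Import finmap ring.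
From mathcomp Require Import boolp classical_sets cardinality.
Local Open Scope ring_scope.

Set Implicit Arguments.
Unset Strict Implicit.
Unset Printing Implicit Defensive.

Import GRing.Theory.

(** * Continued fractions of power series *)

Definition fps_eqmod (N : nat) (a b : fps) : Prop :=
  forall n, (n < N)%N -> fcoef a n = fcoef b n.

Lemma fps_eqmodB N a b a' b' : fps_eqmod N a a' -> fps_eqmod N b b' ->
  fps_eqmod N (a - b) (a' - b').
Proof. by move=> aa' bb' n nN; rewrite /= aa' ?bb'. Qed.

Lemma fps_eqmodM N a b a' b' : fps_eqmod N a a' -> fps_eqmod N b b' ->
  fps_eqmod N (a * b) (a' * b').
Proof.
move=> aa' bb' n nN /=; apply: eq_bigr => i _.
by rewrite aa' ?bb' // (leq_ltn_trans _ nN) ?leq_subr // -ltnS.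
Qed.

(** A factor without constant term shifts the error by one order; this makes the truncations of a
    continued fraction converge. *)
Lemma fps_eqmodMS N a b c : fcoef a 0 = 0 -> fps_eqmod N b c ->
  fps_eqmod N.+1 (a * b) (a * c).
Proof.
move=> a0 bc n nN /=; apply: eq_bigr => -[[|i] /= lt_in] _.
  by rewrite a0 !mul0r.
rewrite bc //; case: n lt_in nN => // n _; rewrite ltnS subSS.
exact: leq_ltn_trans (leq_subr _ _).
Qed.

Lemma fps_eqmodV N a b : a \is a GRing.unit -> b \is a GRing.unit ->
  fps_eqmod N a b -> fps_eqmod N a^-1 b^-1.
Proof.
move=> ua ub ab n nN.
(* Write [a^-1] as [a^-1 * (b * b^-1)] and [b^-1] as [a^-1 * (a * b^-1)], which differ only in the
   middle factor. *)
rewrite -[a^-1]mulr1 -(divrr ub) -[b^-1 in RHS]mul1r -(mulVr ua) -mulrA.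
apply: fps_eqmodM nN => //; apply: fps_eqmodM => // m mN.
by rewrite ab.
Qed.

Lemma fps_unit_1B a : fcoef a 0 = 0 -> 1 - a \is a GRing.unit.
Proof. by move=> a0; rewrite /in_mem /= /fps_unit /= a0. Qed.

Lemma fcoef0M a b : fcoef a 0 = 0 -> fcoef (a * b) 0 = 0.
Proof. by move=> a0; rewrite /= big_ord1 a0 mul0r. Qed.

Lemma fcoef0D a b : fcoef a 0 = 0 -> fcoef b 0 = 0 -> fcoef (a + b) 0 = 0.
Proof. by move=> /= -> ->. Qed.

Lemma fcoef_sum (J : finType) (F : J -> fps) n :
  fcoef (\sum_j F j) n = \sum_j fcoef (F j) n.
Proof. by elim/big_rec2: _ => //= j y x _ <-. Qed.

Lemma fcoef_nat m n : fcoef m%:R n = (m * (n == 0))%N%:Z.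
Proof.
by elim: m => [|m IHm] //; rewrite mulrS /= IHm mulSn PoszD; case: (n == 0%N).
Qed.

Section ContinuedFraction.
Variables (b c : nat -> fps) (i0 : nat).
Hypothesis b0 : forall i, (i0 <= i)%N -> fcoef (b i) 0 = 0.
Hypothesis c0 : forall i, (i0 <= i)%N -> fcoef (c i) 0 = 0.

Lemma cfrac_denom_unit i x : (i0 <= i)%N -> 1 - b i - c i * x \is a GRing.unit.
Proof.
move=> ii; rewrite -addrA -opprD fps_unit_1B // fcoef0D ?b0 //.
by rewrite fcoef0M ?c0.
Qed.

Lemma cfrac_trunc_eqmod N M i : (i0 <= i)%N -> (N <= M)%N ->
  fps_eqmod N.+1 (cfrac_trunc b c N i) (cfrac_trunc b c M i).
Proof.
elim: N M i => [|N IHN] [|M] i ii // NM; apply: fps_eqmodV;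
  rewrite ?cfrac_denom_unit ?fps_unit_1B ?b0 //.
- by move=> [|n] // _; rewrite /= big_ord1 c0 // mul0r subr0.
- apply: fps_eqmodB => //; apply: fps_eqmodMS; first exact: c0.
  by apply: IHN => //; rewrite leqW.
Qed.

Lemma cfrac_exists : exists E : nat -> fps, forall i, (i0 <= i)%N ->
  is_cfrac b c i (E i) /\ E i = (1 - b i - c i * E i.+1)^-1.
Proof.
(* Diagonal limit: coefficient [n] no longer changes from depth [n] on. *)
pose E i := Fps (fun n => fcoef (cfrac_trunc b c n i) n).
have EE N i : (i0 <= i)%N -> fps_eqmod N.+1 (cfrac_trunc b c N i) (E i).
  move=> ii n; rewrite ltnS => nN /=.
  by rewrite (cfrac_trunc_eqmod ii nN).
exists E => i ii; split.
  by move=> n; exists n => m nm; apply: (EE m).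
(* Depth [n.+1] at [i] is one level around depth [n] at [i.+1], which already has the right
   coefficients up to [n]. *)
apply: fpsP => n; rewrite -(@EE n.+1) //.
apply: (@fps_eqmodV n.+1); rewrite ?cfrac_denom_unit //.
apply: fps_eqmodB => //; apply: fps_eqmodM => //.
by apply: EE; rewrite leqW.
Qed.

End ContinuedFraction.

(** * Counting walks *)

Local Open Scope classical_set_scope.
Local Open Scope card_scope.

Lemma card_setU_II T (A B : set T) m n : A `&` B = set0 ->
  A #= `I_m -> B #= `I_n -> A `|` B #= `I_(m + n).
Proof.
(* Finite sets with cardinals need a choice type; [{classic T}] supplies one. *)
suff cU (U : choiceType) (C D : set U) : C `&` D = set0 ->
    C #= `I_m -> D #= `I_n -> C `|` D #= `I_(m + n) by exact: (cU {classic T}).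
move=> CD0 Cm Dn.
have fC : finite_set C by apply/finite_setP; exists m.
have fD : finite_set D by apply/finite_setP; exists n.
have fU : finite_set (C `|` D) by rewrite finite_setU.
rewrite -(fset_setK fU); apply/card_eq_fsetP.
rewrite fset_setU // cardfsU -fset_setI // CD0 fset_set0 cardfs0 subn0.
by rewrite (card_fset_set Cm) (card_fset_set Dn).
Qed.

(** The cardinal is an integer so as to be compared with a coefficient of a series, as in
    [is_genfun]. *)
Definition has_card T (A : set T) (z : int) : Prop :=
  exists2 k : nat, z = k%:Z & A #= `I_k.

Lemma has_card_set0 T : has_card (@set0 T) 0.
Proof. by exists 0%N; rewrite // II0 card_eq00. Qed.

Lemma has_card_image T U (f : T -> U) (A : set T) z : injective f ->
  has_card A z -> has_card (f @` A) z.
Proof.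
move=> f_inj [k -> Ak]; exists k => //.
by apply: card_eq_trans Ak; apply: inj_card_eq => x y _ _ /f_inj.
Qed.

Lemma has_card_bigcup (I : finType) T (F : I -> set T) (z : I -> int) :
  trivIset setT F -> (forall i, has_card (F i) (z i)) ->
  has_card (\bigcup_i F i) (\sum_i z i).
Proof.
move=> tF cF.
suff cs (s : seq I) : uniq s ->
    has_card (\bigcup_(i in [set` s]) F i) (\sum_(i <- s) z i).
  have := cs _ (index_enum_uniq I).
  rewrite (_ : [set` _] = setT) //.
  by apply/seteqP; split => // i _; rewrite /= mem_index_enum.
elim: s => [_|i s IHs /= /andP[nis us]].
  by rewrite big_nil set_nil bigcup_set0; apply: has_card_set0.
have [m zm Fm] := cF i; have [n zn Fn] := IHs us.
rewrite bigcup_seq !big_cons -bigcup_seq zm zn; exists (m + n)%N => //.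
apply: card_setU_II => //; apply/seteqP; split => // x [Fix [j /= js Fjx]].
have ij : i = j by apply: tF => //; exists x.
by rewrite ij js in nis.
Qed.

(** Accepting paths from an arbitrary state, since the induction on length changes the starting
    state. *)
Definition walks (A : automaton) (x : state A) (n : nat) : set (seq (edge A)) :=
  [set s | size s = n /\ exists2 q, final q & is_walk x s q].

Lemma walks0 (A : automaton) (x : state A) :
  walks x 0 = if `[< final x >] then [set [::]] else set0.
Proof.
case: ifPn => [/asboolP fx|/asboolPn fx]; apply/seteqP; split => s //=.
- by case=> /size0nil.
- by move=> ->; split=> //; exists x.
- by case=> /size0nil -> [q fq /= xq]; rewrite xq in fx.
Qed.

(** * Walks along the chains of an expanded automaton *)

Section Expansion.
Variable P : pautomaton.
Implicit Types (c : chain P) (p : pstate P) (e : xedge P).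

Lemma chain_node_ge c k : (clen c <= k.+1)%N ->
  chain_node c k.+1 = Visible (ptgt (ctrans c)).
Proof.
move=> ck /=; case: insubP => // u; rewrite ltnNge => /negP[].
by rewrite -subn1 leq_subLR.
Qed.

Lemma chain_node_lt c k : (k.+1 < clen c)%N ->
  exists2 j : 'I_(clen c).-1, j = k :> nat & chain_node c k.+1 = Hidden j.
Proof.
move=> kc /=; have kc' : (k < (clen c).-1)%N by rewrite -ltnS (ltn_predK kc).
by case: insubP => [u _ uk|]; [exists u|rewrite kc'].
Qed.

(** A hidden state records its chain and its position, which determine the edge leaving it. *)
Lemma esrc_Hidden c k (ck : (k.+1 < clen c)%N) e :
  chain_node (echain e) (epos e) = chain_node c k.+1 ->
  e = XEdge (Ordinal ck).
Proof.
have [j jk ->] := chain_node_lt ck.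
case: e => c' [[|k'] ck'] //= ; have [j' j'k' /= ->] := chain_node_lt ck'.
(* Forgetting the dependent type of the position lets the equality of hidden states be split. *)
pose index (x : xstate P) :=
  if x is Hidden c1 j1 then Some (c1, val j1) else None.
move/(congr1 index) => [cc']; rewrite j'k' jk => kk'.
by case: _ / cc' in ck *; congr XEdge; apply: val_inj; rewrite /= kk'.
Qed.

Lemma esrc_Visible e p : chain_node (echain e) (epos e) = Visible p ->
  epos e = 0%N :> nat /\ psrc (ctrans (echain e)) = p.
Proof.
case: e => c [[|k] ck] /=; first by case.
by have [j _ /= ->] := chain_node_lt ck.
Qed.

(** Inside a chain the walk is forced: [clen c - k.+1] edges lead to the target, and only the rest
    is free. *)
Lemma walks_chain c k n z : (k < clen c)%N -> (clen c - k.+1 <= n)%N ->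
  has_card (@walks (expand P) (Visible (ptgt (ctrans c)))
             (n - (clen c - k.+1))) z ->
  has_card (@walks (expand P) (chain_node c k.+1) n) z.
Proof.
move dE: (clen c - k.+1)%N => d; elim: d k n dE => [|d IHd] k n dE kc dn cz.
  by move/eqP: dE; rewrite subn_eq0 => /chain_node_ge ->; rewrite subn0 in cz.
case: n dn cz => // n dn; rewrite subSS => cz.
have kc' : (k.+1 < clen c)%N by rewrite -subn_gt0 dE.
have dE' : (clen c - k.+2)%N = d by rewrite subnS dE.
have cons_inj : injective (cons (XEdge (Ordinal kc'))) by move=> s t [].
have := has_card_image cons_inj (IHd _ _ dE' kc' dn cz).
congr has_card; apply/seteqP; split => [_ [s [sn [q fq sq]] <-]|].
  by split; [rewrite /= sn|exists q].
move=> [|e s] [] // [sn] [q fq [/esrc_Hidden-> sq]].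
by exists s => //; split=> //; exists q.
Qed.

(** Hidden states are not final, so an accepting walk completes any chain it enters. *)
Lemma walks_chain_eq0 c k n s : (k < clen c)%N ->
  @walks (expand P) (chain_node c k.+1) n s -> (clen c - k.+1 <= n)%N.
Proof.
elim: s k n => [|e s IHs] k n kc [] /= sn [q fq].
  move=> sq; case: (ltnP k.+1 (clen c)) => [kc'|]; last first.
    by rewrite -subn_eq0 => /eqP ->.
  by have [j _ /= xj] := chain_node_lt kc'; rewrite -sq xj in fq.
case: (ltnP k.+1 (clen c)) => [kc'|]; last by rewrite -subn_eq0 => /eqP ->.
case=> /(esrc_Hidden kc') -> sq; rewrite -sn -(subnSK kc') ltnS.
by apply: IHs => //; split=> //; exists q.
Qed.

(** * Solutions of the linear system count walks *)

Section LinearSystem.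
Variables (I : pstate P -> finType) (out : forall p, I p -> ptrans P).
Hypothesis out_inj : forall p, injective (@out p).
Hypothesis outP : forall p t, psrc t = p <-> exists i : I p, out i = t.
Hypothesis plabel0 : forall t, @plabel P t 0 = 0%N.

Variable A : pstate P -> fps.
Hypothesis A_system : forall p, A p = `[< pfinal p >]%:R +
  \sum_(i : I p) ser (plabel (out i)) * A (ptgt (out i)).

Definition out_chain p (i : I p) n (k : 'I_(plabel (out i) n)) : chain P :=
  Chain k.

Lemma fcoef0_system p : fcoef (A p) 0 = `[< pfinal p >]%:Z.
Proof.
rewrite A_system /= fcoef_nat muln1 fcoef_sum big1 ?addr0 // => i _.
by rewrite fcoef0M //= plabel0.
Qed.

(** The label coefficient is spread into a sum over parallel chains, to match [walks_VisibleS] term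
    by term. *)
Lemma fcoefS_system p n : fcoef (A p) n.+1 =
  \sum_(i : I p) \sum_(j < n.+1) \sum_(k < plabel (out i) j.+1)
    fcoef (A (ptgt (out i))) (n - j).
Proof.
rewrite A_system /= fcoef_nat muln0 add0r fcoef_sum; apply: eq_bigr => i _.
rewrite /= big_ord_recl /= plabel0 mul0r add0r; apply: eq_bigr => j _.
by rewrite sumr_const card_ord subSS -mulr_natl natz.
Qed.

(** Walks are sorted by their first edge, which opens chain number [k] of length [j.+1] of the
    transition [out i]. *)
Lemma walks_VisibleS p n : @walks (expand P) (Visible p) n.+1 =
  \bigcup_(i : I p) \bigcup_(j : 'I_n.+1)
    \bigcup_(k : 'I_(plabel (out i) j.+1))
      cons (@XEdge P (out_chain k) ord0) @`
        @walks (expand P) (chain_node (out_chain k) 1) n.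
Proof.
apply/seteqP; split; last first.
  move=> _ [i _ [j _ [k _ [s [sn [q fq sq]] <-]]]].
  split; [by rewrite /= sn|exists q => //; split=> //].
  by rewrite /=; congr Visible; apply/outP; exists i.
move=> [|[[t [|j] k] [l lj]] s] [] // [sn] [q fq [ep sq]].
have [/= l0 tp] := esrc_Visible ep.
have [i it] := (outP _ _).1 tp; case: _ / it in k lj ep sq tp *.
move: lj {ep} sq; rewrite {l}l0 => lj sq.
have ws : @walks (expand P) (chain_node (Chain k) 1) n s.
  by split=> //; exists q.
have jn : (j < n.+1)%N.
  by rewrite ltnS; have := walks_chain_eq0 lj ws; rewrite /= subn1.
exists i => //; exists (Ordinal jn) => //; exists k => //; exists s => //.
by congr (@XEdge _ _ _ :: s); apply: val_inj.
Qed.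

(** Strong induction works because every chain used has at least one edge: a shorter walk remains at
    its target. *)
Lemma has_card_walks n p :
  has_card (@walks (expand P) (Visible p) n) (fcoef (A p) n).
Proof.
elim/ltn_ind: n p => -[|n] IHn p.
  rewrite fcoef0_system walks0.
  case: `[< pfinal p >]; last exact: has_card_set0.
  by exists 1%N => //; apply: card_set1.
rewrite fcoefS_system walks_VisibleS.
apply: has_card_bigcup => [i i' _ _ |i].
  move=> [s [[j _ [k _ [s1 _ <-]]]] [j' _ [k' _ [s2 _ [tt' _ _ _]]]]].
  by apply: out_inj.
apply: has_card_bigcup => [j j' _ _ |j].
  move=> [s [[k _ [s1 _ <-]] [k' _ [s2 _ eqs]]]].
  (* The first edge determines the length of its chain; projecting to [nat] avoids an equality
     between dependent types. *)
  have [jj'] := congr1 (oapp (fun e => clen (echain e)) 0%N \o ohead) eqs.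
  exact: val_inj.
apply: has_card_bigcup => [k k' _ _ |k].
  move=> [s [[s1 _ <-] [s2 _ eqs]]]; apply: val_inj.
  by have := congr1 (oapp (fun e => val (cindex (echain e))) 0%N \o ohead) eqs.
apply: has_card_image => [s t []//|].
have jn : (clen (out_chain k) - 1 <= n)%N by rewrite /= subn1 -ltnS ltn_ord.
apply: walks_chain => //; rewrite /= subn1 /=.
by apply: IHn; rewrite ltnS leq_subr.
Qed.

Lemma genfun_system : is_genfun (expand P) (A (pinit P)).
Proof. by move=> n; apply: has_card_walks. Qed.

End LinearSystem.
End Expansion.

(** * The bilinear automaton *)

(** Three transitions leave every state, so ['I_3] indexes them all. [Negz i] is the state [-(i+1)],
    where [Loop' i] sits. *)
Definition blin_out (p : int) : seq blin_trans :=
  match p with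
  | Posz 0 => [:: Loop 0; Right 0; Left' 0]
  | Posz i.+1 => [:: Loop i.+1; Right i.+1; RightBack i]
  | Negz i => [:: Loop' i; Left' i.+1; LeftBack' i]
  end.

Definition blin_outn (p : int) (i : 'I_3) : blin_trans :=
  nth (Loop 0) (blin_out p) i.

Lemma blin_outn_inj p : injective (blin_outn p).
Proof.
by case: p => [[|n]|n]; move=> [[|[|[|//]]] i3] [[|[|[|//]]] j3] //= _;
  apply: val_inj.
Qed.

Lemma blin_outnP p t : blin_src t = p <-> exists i, blin_outn p i = t.
Proof.
split=> [<-|[[[|[|[|//]]] i3] <-]]; last 3 first.
- by case: p => [[|n]|n].
- by case: p => [[|n]|n].
- by case: p => [[|n]|n].
case: t => [] [|n];
  by [exists (inord 0); rewrite /blin_outn inordK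
     |exists (inord 1); rewrite /blin_outn inordK
     |exists (inord 2); rewrite /blin_outn inordK].
Qed.

(** * Solution of the system along one arm *)

Section Arm.
Variables (b f g E : nat -> fps) (A0 : fps).
Hypothesis E_rec : forall i,
  E i.+1 * (1 - b i.+1 - f i.+1 * g i.+1 * E i.+2) = 1.

(** [g] labels steps towards 0 and [f] steps away. The factor [g j * E j.+1] stands for the walks
    from distance [j.+1] until their first arrival at distance [j]. *)
Definition arm (i : nat) : fps := (\prod_(j < i) (g j * E j.+1)) * A0.

Lemma arm0 : arm 0 = A0.
Proof. by rewrite /arm big_ord0 mul1r. Qed.

Lemma armS i : arm i.+1 = g i * E i.+1 * arm i.
Proof. by rewrite /arm big_ord_recr /= -mulrA mulrCA mulrA. Qed.

Lemma arm_system i :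
  arm i.+1 = b i.+1 * arm i.+1 + f i.+1 * arm i.+2 + g i * arm i.
Proof.
have -> : g i * arm i = (1 - b i.+1 - f i.+1 * g i.+1 * E i.+2) * arm i.+1.
  by rewrite armS -[LHS]mul1r -[in LHS](E_rec i); ring.
by rewrite [arm i.+2]armS; ring.
Qed.

End Arm.

Theorem mainTheorem7 (f g h f' g' h' : nat -> nat -> nat)
  (f_const : forall i : nat, f i 0%N = 0%N)
  (g_const : forall i : nat, g i 0%N = 0%N)
  (h_const : forall i : nat, h i 0%N = 0%N)
  (f'_const : forall i : nat, f' i 0%N = 0%N)
  (g'_const : forall i : nat, g' i 0%N = 0%N)
  (h'_const : forall i : nat, (1 <= i)%N -> h' i 0%N = 0%N) :
  exists E1 E1' : fps,
    [/\ is_cfrac (fun i => ser (h i)) (fun i => ser (f i) * ser (g i)) 1 E1,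
        is_cfrac (fun i => ser (h' i)) (fun i => ser (f' i) * ser (g' i)) 1 E1'
      & is_genfun (expand (BLin f g h f' g' h'))
          (1 - ser (h 0%N) - ser (f 0%N) * ser (g 0%N) * E1
             - ser (f' 0%N) * ser (g' 0%N) * E1')^-1].
Proof.
have ser0 (u : nat -> nat) : u 0%N = 0%N -> fcoef (ser u) 0 = 0 by move=> /= ->.
have fg0 i : fcoef (ser (f i) * ser (g i)) 0 = 0 by rewrite fcoef0M ?ser0.
have fg'0 i : fcoef (ser (f' i) * ser (g' i)) 0 = 0 by rewrite fcoef0M ?ser0.
have h0 i : fcoef (ser (h i)) 0 = 0 by exact: ser0.
have h'0 i : (1 <= i)%N -> fcoef (ser (h' i)) 0 = 0.
  by move=> i1; rewrite ser0 ?h'_const.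
have [E EP] := cfrac_exists (i0 := 1) (fun i _ => h0 i) (fun i _ => fg0 i).
have [E' E'P] := cfrac_exists (i0 := 1) h'0 (fun i _ => fg'0 i).
exists (E 1%N), (E' 1%N); split; [exact: (EP _ _).1|exact: (E'P _ _).1|].
set D := (X in X^-1).
have uD : D \is a GRing.unit.
  by rewrite /D -!addrA -!opprD fps_unit_1B // !fcoef0D ?fcoef0M ?ser0.
have E_rec i : E i.+1 * (1 - ser (h i.+1) -
    ser (f i.+1) * ser (g i.+1) * E i.+2) = 1.
  by rewrite [E i.+1](EP _ _).2 // mulVr // (cfrac_denom_unit (i0 := 1)
    (b := fun i => ser (h i)) (c := fun i => ser (f i) * ser (g i))).
(* On the left [f'] leads towards 0 and [g'] away from it, so their roles are exchanged. *)
have E'_rec i : E' i.+1 * (1 - ser (h' i.+1) -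
    ser (g' i.+1) * ser (f' i.+1) * E' i.+2) = 1.
  rewrite [ser (g' _) * _]mulrC [E' i.+1](E'P _ _).2 // mulVr //.
  by rewrite (cfrac_denom_unit (i0 := 1)
    (b := fun i => ser (h' i)) (c := fun i => ser (f' i) * ser (g' i))).
pose a := arm (fun i => ser (g i)) E D^-1.
pose a' := arm (fun i => ser (f' i)) E' D^-1.
(* Both arms take the value [D^-1] at state 0, so they glue together. *)
pose A (p : int) := match p with Posz i => a i | Negz i => a' i.+1 end.
rewrite (_ : D^-1 = A 0); last exact/esym/arm0.
pose P := BLin f g h f' g' h'.
apply: (@genfun_system P (fun=> 'I_3) blin_outn) => //.
- exact: blin_outn_inj.
- exact: blin_outnP.
- by case=> i //=; rewrite h'_const.
move=> p; rewrite !big_ord_recl big_ord0 addr0 /=.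
have -> : `[< p = 0 >] = (p == 0) by apply/asboolP/eqP.
case: p => [[|i]|i] /=; rewrite /blin_outn /=.
(* At state 0 the final term 1 becomes [D * D^-1], leaving a ring identity in [D^-1]. *)
- rewrite /a /a' !armS !arm0 (_ : _%:R = D * D^-1); last by rewrite mulrV.
  by move: D^-1 => X; rewrite /D; ring.
- rewrite add0r addrA.
  exact: (arm_system (b := fun i => ser (h i)) (f := fun i => ser (f i))
    D^-1 E_rec i).
(* For [i = 0] the neighbour is state 0, stored in the right arm as [a 0], which equals [a' 0]. *)
- rewrite add0r addrA (_ : A (- i%:Z) = a' i).
    exact: (arm_system (b := fun i => ser (h' i)) (f := fun i => ser (g' i))
      D^-1 E'_rec i).
  by case: i => //; rewrite /a' arm0; apply: arm0.
Qed.
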